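(* Let $P=(X,\prec)$ be a finite twin-free interval order. The following are equivalent: (1) $P$ is a unit OC interval order; (2) $P$ is a strict OC interval order; (3) $P$ contains no induced subposet isomorphic to any of $\mathbf{4}+\mathbf{1}$, $\mathbf{3}+\mathbf{1}+\mathbf{1}$, $Z$, $D$, $Y$, or the dual of $Y$.
   Context: Posets are strict (irreflexive) partial orders. Two points are twins if they have exactly the same comparabilities; twin-free means no two distinct twins. $P$ is an interval order if each $x$ can be assigned a closed real interval $[L(x),R(x)]$ with $x\prec y$ iff $R(x)<L(y)$. An OC interval representation assigns to each $x\in X$ a real interval $I(x)$ that is either open or closed such that $x\prec y$ iff every point of $I(x)$ is less than every point of $I(y)$. A unit OC interval order has such a representation with all intervals of the same length. An interval $I(u)$ is strictly contained in $I(v)$ if $I(u)\subset I(v)$ and they do not have identical endpoints; an OC interval representation is strict if no interval is strictly contained in another, and $P$ is a strict OC interval order if it has a strict OC interval representation. Forbidden posets (pairs not listed or implied by transitivity are incomparable): $\mathbf{4}+\mathbf{1}$: $a\prec b\prec c\prec d$, plus isolated $x$. $\mathbf{3}+\mathbf{1}+\mathbf{1}$: $a\prec b\prec c$, plus isolated $x,y$. $Z$: elements $a,b,c,d,x,y$ with $a\prec b\prec c\prec d$, $x\prec d$, $a\prec y$. $D$: elements $a,b,c,d,x$ with $a\prec b\prec d$, $a\prec c\prec d$. $Y$: elements $a,b,c,d,x$ with $a\prec d\prec b$, $a\prec d\prec c$. The dual of a poset reverses all comparabilities. *)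

(* Defs.v *)
From mathcomp Require Import all_boot.
From Stdlib Require Import Reals.
Set Implicit Arguments. Unset Strict Implicit. Unset Printing Implicit Defensive.

Definition strict_porder (X : finType) (lt : rel X) : Prop :=
  (forall x, ~~ lt x x) /\ (forall x y z, lt x y -> lt y z -> lt x z).

Definition twins (X : finType) (lt : rel X) (x y : X) : Prop :=
  forall z, (lt z x = lt z y) /\ (lt x z = lt y z).

Definition twin_free (X : finType) (lt : rel X) : Prop :=
  forall x y, twins lt x y -> x = y.

Definition interval_order (X : finType) (lt : rel X) : Prop :=
  exists L Rt : X -> R,
    (forall x, (L x <= Rt x)%R) /\ (forall x y, lt x y <-> (Rt x < L y)%R).

Record ocint := OCInt { oc_left : R; oc_right : R; oc_closed : bool }.

Definition ocint_wf (I : ocint) : Prop :=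
  if oc_closed I then (oc_left I <= oc_right I)%R else (oc_left I < oc_right I)%R.

Definition in_oc (I : ocint) (t : R) : Prop :=
  if oc_closed I then (oc_left I <= t <= oc_right I)%R
  else (oc_left I < t < oc_right I)%R.

Definition oc_length (I : ocint) : R := (oc_right I - oc_left I)%R.

Definition oc_before (I J : ocint) : Prop :=
  forall s t, in_oc I s -> in_oc J t -> (s < t)%R.

Definition OC_rep (X : finType) (lt : rel X) (I : X -> ocint) : Prop :=
  (forall x, ocint_wf (I x)) /\ (forall x y, lt x y <-> oc_before (I x) (I y)).

Definition OC_interval_order (X : finType) (lt : rel X) : Prop :=
  exists I, OC_rep lt I.

Definition unit_OC_interval_order (X : finType) (lt : rel X) : Prop :=
  exists I, OC_rep lt I /\ (forall x y, oc_length (I x) = oc_length (I y)).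

Definition strictly_contained (I J : ocint) : Prop :=
  (forall t, in_oc I t -> in_oc J t) /\
  ~ (oc_left I = oc_left J /\ oc_right I = oc_right J).

Definition strict_OC_interval_order (X : finType) (lt : rel X) : Prop :=
  exists I, OC_rep lt I /\
    (forall u v, ~ strictly_contained (I u) (I v)).

(** Small posets on 'I_n given by the full (transitively closed) list of
    strict comparabilities (i, j) meaning i ≺ j. *)
Definition rel_of_list (n : nat) (s : seq (nat * nat)) : rel 'I_n :=
  fun i j => (nat_of_ord i, nat_of_ord j) \in s.

Definition dual_rel (X : Type) (r : rel X) : rel X := fun x y => r y x.

(* 4+1 : a=0 < b=1 < c=2 < d=3, x=4 isolated *)
Definition P4p1 : rel 'I_5 :=
  (@rel_of_list 5) [:: (0,1); (0,2); (0,3); (1,2); (1,3); (2,3)].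
(* 3+1+1 : a=0 < b=1 < c=2, x=3, y=4 isolated *)
Definition P3p1p1 : rel 'I_5 :=
  (@rel_of_list 5) [:: (0,1); (0,2); (1,2)].
(* Z : a=0 < b=1 < c=2 < d=3, x=4 < d, a < y=5 *)
Definition PZ : rel 'I_6 :=
  (@rel_of_list 6) [:: (0,1); (0,2); (0,3); (1,2); (1,3); (2,3); (4,3); (0,5)].
(* D : a=0 < b=1 < d=3, a < c=2 < d, x=4 isolated *)
Definition PD : rel 'I_5 :=
  (@rel_of_list 5) [:: (0,1); (1,3); (0,2); (2,3); (0,3)].
(* Y : a=0 < d=1 < b=2, a < d < c=3, x=4 isolated *)
Definition PY : rel 'I_5 :=
  (@rel_of_list 5) [:: (0,1); (1,2); (1,3); (0,2); (0,3)].
Definition PYdual : rel 'I_5 := dual_rel PY.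

Definition contains_induced (X : finType) (lt : rel X) (n : nat) (q : rel 'I_n)
  : Prop :=
  exists f : 'I_n -> X, injective f /\ (forall i j, q i j = lt (f i) (f j)).

Definition forbidden_free (X : finType) (lt : rel X) : Prop :=
  ~ contains_induced lt P4p1 /\ ~ contains_induced lt P3p1p1 /\
  ~ contains_induced lt PZ /\ ~ contains_induced lt PD /\
  ~ contains_induced lt PY /\ ~ contains_induced lt PYdual.

(* Main.v *)
Require Import Defs.
From mathcomp Require Import all_boot.
From Stdlib Require Import Reals Lra.

Set Implicit Arguments.
Unset Strict Implicit.
Unset Printing Implicit Defensive.

(** In a strict representation the middle [b] of a 3+1 formed by [a, b, c] and
    [x] must be the interior of the closed interval [x], and this rules out each
    forbidden poset.  Conversely, when the forbidden posets are absent, every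
    such [b] has a unique hull [x], every [x] has at most one middle, and exactly
    one [a] lies below [b] but not below [x], dually exactly one [c] above.  The
    elements that are not middles are linearly ordered by their sets of
    predecessors and successors, so a greedy choice of left endpoints represents
    them by closed unit intervals in which [a] is made to touch the hull [x] and
    [x] to touch [c].  Each middle then receives the interior of its hull. *)

(** * Order and containment of intervals through their endpoints *)

Lemma oc_point_right (I : ocint) (e : R) :
  ocint_wf I -> (e < oc_right I)%R -> exists2 s, in_oc I s & (e < s)%R.
Proof.
rewrite /ocint_wf /in_oc; case: (oc_closed I) => wf lt_er.
  by exists (oc_right I); lra.
(* Taking the larger of [e] and the left end keeps the midpoint both above [e] and inside the open
   interval. *)
exists ((Rmax e (oc_left I) + oc_right I) / 2)%R;
  by move: (Rmax_l e (oc_left I)) (Rmax_r e (oc_left I))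
           (Rmax_lub_lt _ _ _ lt_er wf); lra.
Qed.

Lemma oc_point_left (I : ocint) (e : R) :
  ocint_wf I -> (oc_left I < e)%R -> exists2 s, in_oc I s & (s < e)%R.
Proof.
rewrite /ocint_wf /in_oc; case: (oc_closed I) => wf lt_le.
  by exists (oc_left I); lra.
exists ((Rmin e (oc_right I) + oc_left I) / 2)%R;
  by move: (Rmin_l e (oc_right I)) (Rmin_r e (oc_right I))
           (Rmin_glb_lt _ _ _ lt_le wf); lra.
Qed.

(** A common endpoint violates the order only if it belongs to both intervals, that is, if both are
    closed. *)
Lemma oc_beforeE (I J : ocint) : ocint_wf I -> ocint_wf J ->
  oc_before I J <->
  (if oc_closed I && oc_closed J then (oc_right I < oc_left J)%R
   else (oc_right I <= oc_left J)%R).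
Proof.
move=> wfI wfJ; split=> [IJ|]; last first.
  by rewrite /oc_before /in_oc; case: (oc_closed I); case: (oc_closed J) => /=;
    move=> ? s t; lra.
case: ifP => [/andP[cI cJ]|_].
  by apply: IJ; rewrite /in_oc ?cI ?cJ; move: wfI wfJ;
    rewrite /ocint_wf cI cJ; lra.
apply: Rnot_lt_le => lt_JI.
(* If the ends overlap, [I] has a point above the midpoint of the overlap and [J] one below it. *)
have [|s sI ms] := @oc_point_right I ((oc_right I + oc_left J) / 2) wfI; first lra.
have [|t tJ tm] := @oc_point_left J ((oc_right I + oc_left J) / 2) wfJ; first lra.
by have := IJ _ _ sI tJ; lra.
Qed.

Lemma oc_subset_endpoints (I J : ocint) : ocint_wf I -> ocint_wf J ->
  (forall t, in_oc I t -> in_oc J t) ->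
  (oc_left J <= oc_left I)%R /\ (oc_right I <= oc_right J)%R.
Proof.
move=> wfI wfJ sub; split; apply: Rnot_lt_le => lt_e.
  have [s /sub + lt_s] := oc_point_left wfI lt_e.
  by rewrite /in_oc; case: (oc_closed J); lra.
have [s /sub + lt_s] := oc_point_right wfI lt_e.
by rewrite /in_oc; case: (oc_closed J); lra.
Qed.

Lemma unit_OC_strict (X : finType) (lt : rel X) :
  unit_OC_interval_order lt -> strict_OC_interval_order lt.
Proof.
move=> [I [[wf rep] len]]; exists I; split=> // u v [sub neq]; apply: neq.
have := oc_subset_endpoints (wf u) (wf v) sub; have := len u v.
by rewrite /oc_length; lra.
Qed.

(** * Strict representations exclude the forbidden posets *)

Section StrictForbidden.
Variables (X : finType) (lt : rel X) (I : X -> ocint).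
Hypothesis free : twin_free lt.
Hypothesis repI : OC_rep lt I.
Hypothesis strictI : forall u v, ~ strictly_contained (I u) (I v).

Let l x := oc_left (I x).
Let r x := oc_right (I x).
Let cl x := oc_closed (I x).

Lemma rep_inj x y : l x = l y -> r x = r y -> cl x = cl y -> x = y.
Proof.
rewrite /l /r /cl => el er ec; apply: free => z.
have eI : I x = I y by move: el er ec; case: (I x) (I y) => ? ? ? [? ? ?] /= -> -> ->.
have [_ rep] := repI; have iff_eq (a b : bool) : (a <-> b) -> a = b.
  by case: a b => -[] // [h1 h2]; [have := h1 | have := h2]; move/(_ isT).
by split; apply: iff_eq; rewrite !rep eI.
Qed.

Lemma rep_ltE x y : lt x y <->
  (if cl x && cl y then (r x < l y)%R else (r x <= l y)%R).
Proof. by have [wf rep] := repI; rewrite rep; apply: oc_beforeE. Qed.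

Lemma rep_ltT x y : lt x y -> (r x <= l y)%R /\ (cl x -> cl y -> r x < l y)%R.
Proof. by move=> /rep_ltE; case: (cl x); case: (cl y) => /= ?; split=> // *; lra. Qed.

Lemma rep_ltF x y : ~~ lt x y -> (l y <= r x)%R /\ (cl x && cl y \/ l y < r x)%R.
Proof.
move=> /negP nlt; case: (Rle_lt_dec (r x) (l y)) => [le|?]; last first.
  by split; [lra | right].
case e: (cl x && cl y); last by case: nlt; apply/rep_ltE; rewrite e.
split; last by left.
by apply: Rnot_lt_le => lt_r; apply: nlt; apply/rep_ltE; rewrite e.
Qed.

Lemma rep_wf x : (l x <= r x)%R /\ (cl x = false -> l x < r x)%R.
Proof.
have [/(_ x) wf _] := repI; move: wf; rewrite /ocint_wf /cl /l /r.
by case: (oc_closed _) => wf; split=> // *; lra.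
Qed.

(** As [a] and [c] reach [x] but not [b], the interval of [b] lies in that of [x], and strictness
    equates their endpoints. Then [a] and [x] share just one endpoint, so both are closed, and [b]
    must be open to stay clear of [a]; likewise for [c]. *)
Lemma rep_middle a b c x : lt a b -> lt b c -> ~~ lt a x -> ~~ lt x c ->
  [/\ l b = l x, r b = r x, cl b = false, cl x = true & cl a && cl c]
  /\ r a = l x /\ l c = r x.
Proof.
move=> ab bc nax nxc.
have sub : forall t, in_oc (I b) t -> in_oc (I x) t.
  move=> t; rewrite /in_oc -/(cl b) -/(cl x) -/(l b) -/(l x) -/(r b) -/(r x).
  move: (rep_ltT ab) (rep_ltT bc) (rep_ltF nax) (rep_ltF nxc).
  case: (cl a); case: (cl b); case: (cl c); case: (cl x) => /=;
    move=> [? ab'] [? bc'] [? [?|?]] [? [?|?]]; try done;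
    by try (have := ab' isT isT); try (have := bc' isT isT); lra.
have [el er] : l b = l x /\ r b = r x.
  case: (Req_dec (l b) (l x)) => ?; last by case: (@strictI b x); split=> // -[].
  case: (Req_dec (r b) (r x)) => ?; last by case: (@strictI b x); split=> // -[].
  by [].
move: (rep_ltT ab) (rep_ltT bc) (rep_ltF nax) (rep_ltF nxc).
case: (cl a); case: (cl b); case: (cl c); case: (cl x) => /=;
    move=> [? ab'] [? bc'] [? [?|?]] [? [?|?]]; try done;
    by try (have := ab' isT isT); try (have := bc' isT isT); repeat split=> //; lra.
Qed.

(** Closed intervals with a common left end are nested, so strictness makes them equal and
    twin-freeness identifies their elements. *)
Lemma closed_left_inj b c : cl b -> cl c -> l b = l c -> b = c.
Proof.
have aux u v : cl u -> cl v -> l u = l v -> (r u <= r v)%R -> u = v.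
  move=> cu cv el ler; apply: rep_inj; rewrite // ?cu ?cv //.
  case: (Req_dec (r u) (r v)) => // ne; case: (@strictI u v); split; last by case.
  move=> t; rewrite /in_oc -/(cl u) -/(cl v) cu cv; rewrite /l /r in el ler; lra.
move=> cb cc el; case: (Rle_dec (r b) (r c)) => le; first exact: aux.
by apply/esym/aux => //; lra.
Qed.

Lemma closed_right_inj b c : cl b -> cl c -> r b = r c -> b = c.
Proof.
have aux u v : cl u -> cl v -> r u = r v -> (l v <= l u)%R -> u = v.
  move=> cu cv er lel; apply: rep_inj; rewrite // ?cu ?cv //.
  case: (Req_dec (l u) (l v)) => // ne; case: (@strictI u v); split; last by case.
  move=> t; rewrite /in_oc -/(cl u) -/(cl v) cu cv; rewrite /l /r in er lel; lra.
move=> cb cc er; case: (Rle_dec (l c) (l b)) => le; first exact: aux.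
by apply/esym/aux => //; lra.
Qed.

Notation o0 := (@Ordinal 5 0 isT).
Notation o1 := (@Ordinal 5 1 isT).
Notation o2 := (@Ordinal 5 2 isT).
Notation o3 := (@Ordinal 5 3 isT).
Notation o4 := (@Ordinal 5 4 isT).

Lemma strict_forbidden_free : forbidden_free lt.
Proof.
have mid5 (q : rel 'I_5) (f : 'I_5 -> X) (i j k m : 'I_5) :
    (forall i j, q i j = lt (f i) (f j)) ->
    [&& q i j, q j k, ~~ q i m & ~~ q m k] ->
    [/\ l (f j) = l (f m), r (f j) = r (f m), cl (f j) = false, cl (f m) = true
      & cl (f i) && cl (f k)] /\ r (f i) = l (f m) /\ l (f k) = r (f m).
  by move=> fE; rewrite !fE => /and4P[*]; apply: rep_middle.
split; [|split; [|split; [|split; [|split]]]]; move=> [f [finj fE]].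
(* For 4+1, both inner elements of the chain would be the interior of [x], yet one precedes the
   other. *)
- have [[lb rb cb cx _] _] := mid5 _ f o0 o1 o2 o4 fE isT.
  have [[lc rc cc _ _] _] := mid5 _ f o1 o2 o3 o4 fE isT.
  have /rep_ltT[? _] : lt (f o1) (f o2) by rewrite -fE.
  have [_ /(_ cb)] := rep_wf (f o1); lra.
- have [[lx rx _ cx _] _] := mid5 _ f o0 o1 o2 o3 fE isT.
  have [[ly ry _ cy _] _] := mid5 _ f o0 o1 o2 o4 fE isT.
  by have /finj : f o3 = f o4 by apply: rep_inj; rewrite -?lx -?rx ?cx.
(* For Z, [x] ends where [b] ends, hence no later than [c] starts; as [c] is open, [x] would precede
   [c]. *)
- pose p k lt_k6 := f (@Ordinal 6 k lt_k6).
  have [[lb rb cb cx _] _] := @rep_middle (p 0 isT) (p 1 isT) (p 2 isT) (p 4 isT)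
    ltac:(by rewrite -fE) ltac:(by rewrite -fE) ltac:(by rewrite -fE) ltac:(by rewrite -fE).
  have [[lc rc cc cy _] _] := @rep_middle (p 1 isT) (p 2 isT) (p 3 isT) (p 5 isT)
    ltac:(by rewrite -fE) ltac:(by rewrite -fE) ltac:(by rewrite -fE) ltac:(by rewrite -fE).
  have /rep_ltT[bc _] : lt (p 1 isT) (p 2 isT) by rewrite -fE.
  have /rep_ltF[_] : ~~ lt (p 4 isT) (p 2 isT) by rewrite -fE.
  by rewrite cc andbF => -[//|]; lra.
- have [[lb rb cb _ _] _] := mid5 _ f o0 o1 o3 o4 fE isT.
  have [[lc rc cc _ _] _] := mid5 _ f o0 o2 o3 o4 fE isT.
  by have /finj : f o1 = f o2 by apply: rep_inj; rewrite ?lb ?rb ?cb.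
- have [[_ _ _ _ /andP[_ cb]] [_ lb]] := mid5 _ f o0 o1 o2 o4 fE isT.
  have [[_ _ _ _ /andP[_ cc]] [_ lc]] := mid5 _ f o0 o1 o3 o4 fE isT.
  by have /finj : f o2 = f o3 by apply: closed_left_inj; rewrite ?lb.
- have [[_ _ _ _ /andP[cb _]] [lb _]] := mid5 _ f o2 o1 o0 o4 fE isT.
  have [[_ _ _ _ /andP[cc _]] [lc _]] := mid5 _ f o3 o1 o0 o4 fE isT.
  by have /finj : f o2 = f o3 by apply: closed_right_inj; rewrite ?lb.
Qed.
End StrictForbidden.

(** * The forbidden posets as elementary clauses on the order *)

Section Forbidden.
Variables (X : finType) (lt : rel X).
Hypothesis irr : forall x, ~~ lt x x.
Hypothesis tr : forall x y z, lt x y -> lt y z -> lt x z.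
Hypothesis free22 : forall a b c d, lt a b -> lt c d -> lt a d || lt c b.

(** Listing the vertices turns an induced embedding into a finite table of comparabilities, which
    the tactics below decide entry by entry. *)
Lemma contains_inducedI (x0 : X) (n : nat) (l : seq (nat * nat)) (s : seq X) :
  size s = n -> uniq s ->
  all (fun i => all (fun j =>
    ((i, j) \in l) == lt (nth x0 s i) (nth x0 s j)) (iota 0 n)) (iota 0 n) ->
  contains_induced lt (@rel_of_list n l).
Proof.
move=> sz_s uniq_s /allP ok; exists (fun i : 'I_n => nth x0 s i); split.
  by move=> i j /eqP; rewrite nth_uniq ?sz_s // => /eqP/val_inj.
move=> i j; apply/eqP.
have iotaP (k : 'I_n) : val k \in iota 0 n by rewrite mem_iota /=.
by move/allP: (ok i (iotaP i)) => /(_ j (iotaP j)).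
Qed.

Ltac saturate := repeat match goal with
  | H : is_true (lt ?p ?q), K : is_true (lt ?q ?r) |- _ =>
    lazymatch goal with
    | _ : is_true (lt p r) |- _ => fail
    | _ => have := tr H K; move=> ?
    end
  end.
Ltac contra := saturate; match goal with
  | H : is_true (lt ?p ?p) |- _ => by move: (irr p); rewrite H
  | H : is_true (lt ?p ?q), K : is_true (~~ lt ?p ?q) |- _ => by rewrite H in K
  | H : is_true (?p != ?p) |- _ => by rewrite eqxx in H
  end.
Ltac decide_lt :=
  by do ?[match goal with
  | |- context [lt ?p ?q] =>
    first [ have -> : lt p q = true by saturate; assumption
          | have -> : lt p q = false by apply/negP=> ?; contra ]
  end].
Ltac decide_uniq :=
  rewrite /= !inE !negb_or -!andbA; do ?[apply/andP; split]; rewrite // eq_sym;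
  by apply/eqP=> ?; subst; contra.

Lemma free_4p1 : ~ contains_induced lt P4p1 -> forall a b c d x,
  lt a b -> lt b c -> lt c d -> ~~ lt a x -> ~~ lt x d -> False.
Proof.
move=> no a b c d x ab bc cd nax nxd; apply: no.
apply: (@contains_inducedI a 5 _ [:: a; b; c; d; x]) => //.
  decide_uniq.
by move=> /=; decide_lt.
Qed.

Lemma free_3p1p1 : ~ contains_induced lt P3p1p1 -> forall a b c x y,
  lt a b -> lt b c -> ~~ lt a x -> ~~ lt x c -> ~~ lt a y -> ~~ lt y c -> x = y.
Proof.
move=> no a b c x y ab bc nax nxc nay nyc; apply/eqP/negP=> /negP neq; apply: no.
have nxy : ~~ lt x y by apply/negP=> xy; case/orP: (free22 xy ab) => ?; contra.
have nyx : ~~ lt y x by apply/negP=> yx; case/orP: (free22 yx ab) => ?; contra.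
apply: (@contains_inducedI a 5 _ [:: a; b; c; x; y]) => //.
  decide_uniq.
by move=> /=; decide_lt.
Qed.

(** The relations [lt x d] and [lt a y] of Z come for free: failing either, the chain and that
    element form a 4+1. *)
Lemma free_Z : ~ contains_induced lt P4p1 -> ~ contains_induced lt PZ ->
  forall a b c d x y, lt a b -> lt b c -> lt c d ->
  ~~ lt a x -> ~~ lt x c -> ~~ lt b y -> ~~ lt y d -> False.
Proof.
move=> no41 no a b c d x y ab bc cd nax nxc nby nyd; apply: no.
have xd : lt x d by apply/negPn/negP=> nxd; apply: (free_4p1 no41 ab bc cd nax).
have ay : lt a y by apply/negPn/negP=> nay; apply: (free_4p1 no41 ab bc cd nay).
have nxy : ~~ lt x y by apply/negP=> xy; case/orP: (free22 xy bc) => ?; contra.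
apply: (@contains_inducedI a 6 _ [:: a; b; c; d; x; y]) => //.
  decide_uniq.
by move=> /=; decide_lt.
Qed.

Lemma free_D : ~ contains_induced lt P4p1 -> ~ contains_induced lt PD ->
  forall a b c d x, lt a b -> lt b d -> lt a c -> lt c d ->
  ~~ lt a x -> ~~ lt x d -> b = c.
Proof.
move=> no41 no a b c d x ab bd ac cd nax nxd.
apply/eqP/negP=> /negP neq; apply: no.
have nbc : ~~ lt b c by apply/negP=> bc; apply: (free_4p1 no41 ab bc cd nax).
have ncb : ~~ lt c b by apply/negP=> cb; apply: (free_4p1 no41 ac cb bd nax).
apply: (@contains_inducedI a 5 _ [:: a; b; c; d; x]) => //.
  decide_uniq.
by move=> /=; decide_lt.
Qed.

Lemma free_Y : ~ contains_induced lt P4p1 -> ~ contains_induced lt PY ->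
  forall a d b c x, lt a d -> lt d b -> lt d c ->
  ~~ lt a x -> ~~ lt x b -> ~~ lt x c -> b = c.
Proof.
move=> no41 no a d b c x ad db dc nax nxb nxc.
apply/eqP/negP=> /negP neq; apply: no.
have nbc : ~~ lt b c by apply/negP=> bc; apply: (free_4p1 no41 ad db bc nax).
have ncb : ~~ lt c b by apply/negP=> cb; apply: (free_4p1 no41 ad dc cb nax).
apply: (@contains_inducedI a 5 _ [:: a; d; b; c; x]) => //.
  decide_uniq.
by move=> /=; decide_lt.
Qed.

Lemma free_Ydual : ~ contains_induced lt P4p1 -> ~ contains_induced lt PYdual ->
  forall a b c d x, lt a c -> lt b c -> lt c d ->
  ~~ lt a x -> ~~ lt b x -> ~~ lt x d -> a = b.
Proof.
move=> no41 no a b c d x ac bc cd nax nbx nxd.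
apply/eqP/negP=> /negP neq; apply: no.
have nab : ~~ lt a b by apply/negP=> ab; apply: (free_4p1 no41 ab bc cd nax).
have nba : ~~ lt b a by apply/negP=> ba; apply: (free_4p1 no41 ba ac cd nbx).
(* [PYdual] is not literally a [rel_of_list], so the pairs of [PY] are reversed by hand. *)
suff [f [finj fE]] : contains_induced lt (@rel_of_list 5
    [:: (1, 0); (2, 1); (3, 1); (2, 0); (3, 0)]).
  exists f; split=> // i j; rewrite -fE.
  by case: i j => [[|[|[|[|[|i]]]]] lti] [[|[|[|[|[|j]]]]] ltj].
apply: (@contains_inducedI a 5 _ [:: d; c; a; b; x]) => //.
  decide_uniq.
by move=> /=; decide_lt.
Qed.

End Forbidden.

(* Each clause keeps only comparabilities from which the remaining ones of the
   forbidden poset follow, which makes the list of clauses self-dual. *)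
Record forbidden_axioms (X : finType) (lt : rel X) : Prop := ForbiddenAxioms {
  fa_irr : forall x, ~~ lt x x;
  fa_trans : forall x y z, lt x y -> lt y z -> lt x z;
  fa_22 : forall a b c d, lt a b -> lt c d -> lt a d || lt c b;
  fa_4p1 : forall a b c d x,
    lt a b -> lt b c -> lt c d -> ~~ lt a x -> ~~ lt x d -> False;
  fa_3p1p1 : forall a b c x y, lt a b -> lt b c ->
    ~~ lt a x -> ~~ lt x c -> ~~ lt a y -> ~~ lt y c -> x = y;
  fa_Z : forall a b c d x y, lt a b -> lt b c -> lt c d ->
    ~~ lt a x -> ~~ lt x c -> ~~ lt b y -> ~~ lt y d -> False;
  fa_D : forall a b c d x, lt a b -> lt b d -> lt a c -> lt c d ->
    ~~ lt a x -> ~~ lt x d -> b = c;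
  fa_Y : forall a d b c x, lt a d -> lt d b -> lt d c ->
    ~~ lt a x -> ~~ lt x b -> ~~ lt x c -> b = c;
  fa_Ydual : forall a b c d x, lt a c -> lt b c -> lt c d ->
    ~~ lt a x -> ~~ lt b x -> ~~ lt x d -> a = b
}.

(** Reversal exchanges the clauses for Y and its dual and maps each other clause to itself; facts on
    successors then follow from those on predecessors. *)
Lemma forbidden_axioms_dual (X : finType) (lt : rel X) :
  forbidden_axioms lt -> forbidden_axioms (dual_rel lt).
Proof.
move=> [irr tr f22 f41 f311 fZ fD fY fYd]; rewrite /dual_rel; split=> /=.
- by [].
- by move=> x y z yx zy; apply: tr zy yx.
- by move=> a b c d ba dc; rewrite orbC; apply: (f22 _ _ _ _ ba dc).
- by move=> a b c d x ba cb dc nxa ndx; apply: (f41 _ _ _ _ _ dc cb ba ndx nxa).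
- by move=> a b c x y ba cb ? ? ? ?; apply: (f311 _ _ _ x y cb ba).
- by move=> a b c d x y ba cb dc ? ? ? ?; apply: (fZ _ _ _ _ y x dc cb ba).
- by move=> a b c d x ba db ca dc ? ?; apply: (fD d b c a x).
- by move=> a d b c x da bd cd ? ? ?; apply: (fYd b c d a x).
- by move=> a b c d x ca cb dc ? ? ?; apply: (fY d c a b x).
Qed.

Lemma forbidden_free_axioms (X : finType) (lt : rel X) :
  strict_porder lt -> interval_order lt -> forbidden_free lt ->
  forbidden_axioms lt.
Proof.
move=> [irr tr] [L [Rt [LR ltE]]] [no41 [no311 [noZ [noD [noY noYd]]]]].
have free22 a b c d : lt a b -> lt c d -> lt a d || lt c b.
  move=> /ltE ab /ltE cd; apply/orP.
  case: (Rlt_le_dec (Rt a) (L d)) => ?; first by left; apply/ltE.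
  by right; apply/ltE; lra.
split=> //.
- exact: free_4p1.
- exact: free_3p1p1.
- exact: free_Z.
- exact: free_D.
- exact: free_Y.
- exact: free_Ydual.
Qed.

(** * Greedy placement of points with two thresholds *)

Lemma seq_Rmax (X : eqType) (g : X -> R) (s : seq X) :
  s != [::] -> exists2 x, x \in s & forall y, y \in s -> (g y <= g x)%R.
Proof.
elim: s => // a [|b s] IH _.
  by exists a => [|y]; rewrite inE ?eqxx // => /eqP->; apply: Rle_refl.
have [//|x xs xmax] := IH; case: (Rle_lt_dec (g a) (g x)) => [ax|xa].
  by exists x => [|y]; rewrite inE ?xs ?orbT // => /orP[/eqP->|/xmax].
exists a => [|y]; rewrite inE ?eqxx // => /orP[/eqP->|/xmax]; lra.
Qed.

Lemma finite_between (X : finType) (P Q : pred X) (g h : X -> R) :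
  (forall x y, P x -> Q y -> (g x < h y)%R) ->
  exists m, (forall x, P x -> (g x < m)%R) /\ (forall y, Q y -> (m < h y)%R).
Proof.
move=> gh.
case: (eqVneq (enum P) [::]) => [P0|/(seq_Rmax g)[x]]; last first.
  rewrite mem_enum => Px xmax.
  have {}xmax y : P y -> (g y <= g x)%R by move=> Py; apply: xmax; rewrite mem_enum.
  case: (eqVneq (enum Q) [::]) => [Q0|/(seq_Rmax (fun y => - h y)%R)[y]].
    exists (g x + 1)%R; split=> [y /xmax|y Qy]; first lra.
    by have := mem_enum Q y; rewrite Q0 [y \in Q]Qy.
  rewrite mem_enum => Qy ymin; have xy := gh _ _ Px Qy.
  exists ((g x + h y) / 2)%R; split=> [z /xmax|z Qz]; first lra.
  by have := ymin z; rewrite mem_enum => /(_ Qz); lra.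
have {}P0 x : P x -> False.
  by move=> Px; have := mem_enum P x; rewrite P0 [x \in P]Px.
case: (eqVneq (enum Q) [::]) => [Q0|/(seq_Rmax (fun y => - h y)%R)[y]].
  exists 0%R; split=> [x /P0 //|y Qy].
  by have := mem_enum Q y; rewrite Q0 [y \in Q]Qy.
rewrite mem_enum => Qy ymin; exists (h y - 1)%R; split=> [x /P0 //|z Qz].
by have := ymin z; rewrite mem_enum => /(_ Qz); lra.
Qed.

(* Adds the elements by increasing [key]: a new [y] lands exactly at distance 1
   from the [t] with [W t y && ~~ S t y] if there is one, and otherwise strictly
   between finitely many lower and upper bounds. *)
Lemma double_threshold_rep (X : finType) (S W : rel X) (key : X -> nat)
    (A : {set X}) :
  {in A &, injective key} -> subrel S W ->
  {in A &, forall x y, W x y -> key x < key y} ->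
  {in A &, forall x y, {in A &, forall x' y', W x y ->
     key x' <= key x -> key y <= key y' -> (x' != x) || (y' != y) -> S x' y'}} ->
  exists f : X -> R, {in A &, forall x y,
    [/\ key x < key y -> (f x < f y)%R,
        S x y <-> (f x + 1 < f y)%R & W x y <-> (f x + 1 <= f y)%R]}.
Proof.
move=> + SW; have [n le_n] := ubnP #|A|; elim: n A le_n => // n IH A le_n keyI keyW mono.
case: (set_0Vmem A) => [->|[a aA]]; first by exists (fun=> 0%R) => x; rewrite inE.
case: (arg_maxnP key aA) => y yA' ymax {a aA}.
have yA : y \in A by [].
have {}ymax x : x \in A -> key x <= key y by move/ymax.
pose B := A :\ y.
have BA x : x \in B -> x \in A by rewrite inE => /andP[].
have By x : x \in B -> key x < key y.
  rewrite inE => /andP[/[!inE] xy xA]; rewrite ltn_neqAle (ymax x xA) andbT.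
  by apply: contraNneq xy => /keyI->.
have [||x z xB zB|x z xB zB x' z' xB' zB'|f fP] := IH B.
- by move: le_n; rewrite (cardsD1 y A) yA.
- by move=> x z /BA xA /BA zA; apply: keyI.
- by apply: keyW; apply: BA.
- by apply: mono; apply: BA.
suff [v vP] : exists v : R, forall x, x \in B ->
    [/\ (f x < v)%R, S x y <-> (f x + 1 < v)%R & W x y <-> (f x + 1 <= v)%R].
  have Wyx x : x \in A -> W y x = false.
    move=> xA; apply/negP=> /(keyW _ _ yA xA).
    by rewrite ltnNge (ymax x xA).
  have Syx x : x \in A -> S y x = false.
    by move=> xA; apply/negP=> /SW; rewrite Wyx.
  exists (fun x => if x == y then v else f x) => x z xA zA.
  case: (eqVneq x y) xA => [-> _|xy xA].
    rewrite Wyx ?Syx // ltnNge (ymax z zA).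
    case: (eqVneq z y) => [_|zy]; first by split=> //; split=> //; lra.
    have [] := vP z; first by rewrite !inE zy.
    by move=> *; split=> //; split=> //; lra.
  have xB : x \in B by rewrite !inE xy.
  case: (eqVneq z y) => [->|zy]; first by have [? ? ?] := vP x xB.
  by apply: fP => //; rewrite !inE zy.
(* Monotonicity yields [S x y] as soon as [x] is [W]-below an earlier element, or some element with
   a larger key than [x] is [W]-below [y]. *)
have Wlt x z : x \in B -> z \in B -> W x z -> S x y.
  move=> xB zB Wxz; apply: (mono x z) => //; try exact: BA.
    exact/ltnW/By.
  by apply/orP; right; apply: contraTneq (By z zB) => ->; rewrite ltnn.
have Wle x z : x \in B -> z \in B -> W z y -> key x < key z -> S x y.
  move=> xB zB Wzy xz; apply: (mono z y) => //; try exact: BA.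
    exact: ltnW.
  by apply/orP; left; apply: contraTneq xz => ->; rewrite ltnn.
case: (pickP [pred t in B | W t y && ~~ S t y]) => [t /and3P[tB Wt nSt]|noT].
  (* Elements with a smaller key than [t] are [S]-below [y], those with a larger key are not even
     [W]-below it. *)
  exists (f t + 1)%R => x xB.
  have [tx1 tx2 tx3] := fP t x tB xB; have [xt1 xt2 xt3] := fP x t xB tB.
  case: (ltngtP (key x) (key t)) => [xt|tx|/keyI e].
  - have Sx := Wle _ _ xB tB Wt xt; have := xt1 xt.
    by have Wx := SW _ _ Sx; move=> *; split; [|split=> // _|split=> // _]; lra.
  - have nWx : ~ W x y by move=> Wx; rewrite (Wle _ _ tB xB Wx tx) in nSt.
    have nSx : ~ S x y by move=> /SW.
    have nWtx : ~ (f t + 1 <= f x)%R.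
      by move=> /tx3 Wtx; rewrite (Wlt _ _ tB xB Wtx) in nSt.
    have := tx1 tx.
    by move=> *; split; [|split=> // ?|split=> // ?]; try lra; exfalso; lra.
  - rewrite e ?BA // Wt (negPf nSt).
    by split; [|split=> // ?|split=> // ?]; lra.
(* With no exact contact required, [S x y] and [W x y] agree, so all constraints on the new value
   are strict. *)
have [|v [lo hi]] := @finite_between X (mem B) [pred x in B | ~~ W x y]
    (fun x => if S x y then f x + 1 else f x)%R (fun x => f x + 1)%R.
  move=> x z /= xB /andP[zB nWz]; case: ifP => [Sx|nSx].
    have xz : key x < key z.
      rewrite ltnNge leq_eqVlt; apply: contra nWz => /orP[/eqP/keyI->|zx];
        rewrite ?BA //; first exact: SW.
      by apply/SW/(Wle _ _ zB xB) => //; apply: SW.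
    by have [/(_ xz)] := fP x z xB zB; lra.
  have [_ _ zx3] := fP z x zB xB; apply: Rnot_le_lt => /zx3 /(Wlt _ _ zB xB) /SW Wz.
  by rewrite Wz in nWz.
exists v => x xB; have := lo x xB; have := hi x; rewrite /= xB /=.
have := noT x; rewrite /= xB /=; have := SW x y.
case: (S x y); case: (W x y) => //= sw _ h ?; last have := h isT; last 1 first.
- by move=> ?; split; [|split=> // ?|split=> // ?]; lra.
- by split; [|split=> // _|split=> // _]; lra.
- by have := sw isT.
Qed.

(** * Middles, their hulls, and the order on the remaining elements *)

Definition nested (X : finType) (lt : rel X) (b x : X) : bool :=
  [exists a, lt a b && ~~ lt a x] && [exists c, lt b c && ~~ lt x c].

Definition inner (X : finType) (lt : rel X) (b : X) : bool :=
  [exists x, nested lt b x].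

(** The default [b] makes every non-middle its own hull. *)
Definition hull (X : finType) (lt : rel X) (b : X) : X :=
  odflt b [pick x | nested lt b x].

(* The pairs whose closed unit intervals will share exactly one endpoint. *)
Definition touch (X : finType) (lt : rel X) (p q : X) : bool :=
  [exists b, nested lt b q && (lt p b && ~~ lt p q)] ||
  [exists b, nested lt b p && (lt b q && ~~ lt p q)].

Definition weak_lt (X : finType) (lt : rel X) (p q : X) : bool :=
  lt p q || touch lt p q.

(** Both terms grow as predecessors are gained and successors lost, so the sum ranks the non-middles
    along their linear order. *)
Definition trace_key (X : finType) (lt : rel X) (x : X) : nat :=
  #|[set z | lt z x]| + #|[set z | ~~ lt x z]|.

Section Nested.
Variables (X : finType) (lt : rel X).
Hypothesis ax : forbidden_axioms lt.

Lemma nestedP b x : reflect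
  (exists a c, [/\ lt a b, ~~ lt a x, lt b c & ~~ lt x c]) (nested lt b x).
Proof.
apply: (iffP andP) => [[/existsP[a /andP[? ?]] /existsP[c /andP[? ?]]]|].
  by exists a, c.
by move=> [a [c [ab ax' bc xc]]]; split; apply/existsP; [exists a|exists c];
  apply/andP.
Qed.

Lemma nested_dual b x : nested (dual_rel lt) b x = nested lt b x.
Proof. by rewrite /nested andbC. Qed.

Lemma inner_dual b : inner (dual_rel lt) b = inner lt b.
Proof. by apply: eq_existsb => x; rewrite nested_dual. Qed.

Lemma nested_pred b x z : nested lt b x -> lt z x -> lt z b.
Proof.
move=> /nestedP[a [c [ab nax _ _]]] zx.
by have := fa_22 ax zx ab; rewrite (negPf nax) orbF.
Qed.

(** By [fa_22] one [a0] and one [c0] serve both hulls, and two distinct hulls would give a 3+1+1. *)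
Lemma nested_hull_uniq b x y : nested lt b x -> nested lt b y -> x = y.
Proof.
move=> /nestedP[a [c [ab nax bc nxc]]] /nestedP[a' [c' [a'b na'y bc' nyc']]].
have [a0 [a0b na0x na0y]] : exists a0, [/\ lt a0 b, ~~ lt a0 x & ~~ lt a0 y].
  case: (boolP (lt a y)) => [ay|]; last by exists a.
  exists a'; split=> //; apply/negP=> a'x; have := fa_22 ax ay a'x.
  by rewrite (negPf nax) (negPf na'y).
have [c0 [bc0 nxc0 nyc0]] : exists c0, [/\ lt b c0, ~~ lt x c0 & ~~ lt y c0].
  case: (boolP (lt y c)) => [yc|]; last by exists c.
  exists c'; split=> //; apply/negP=> xc'; have := fa_22 ax yc xc'.
  by rewrite (negPf nxc) (negPf nyc').
exact: (fa_3p1p1 ax a0b bc0 na0x nxc0 na0y nyc0).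
Qed.

Lemma nested_inner_uniq b b' x : nested lt b x -> nested lt b' x -> b = b'.
Proof.
move=> /nestedP[a [c [ab nax bc nxc]]] /nestedP[a' [c' [a'b na'x bc' nxc']]].
have [a0 [a0b a0b' na0x]] : exists a0, [/\ lt a0 b, lt a0 b' & ~~ lt a0 x].
  by case/orP: (fa_22 ax ab a'b) => ?; [exists a|exists a'].
have [c0 [bc0 bc0' nxc0]] : exists c0, [/\ lt b c0, lt b' c0 & ~~ lt x c0].
  by case/orP: (fa_22 ax bc bc') => ?; [exists c'|exists c].
exact: (fa_D ax a0b bc0 a0b' bc0' na0x nxc0).
Qed.

(** If [x] were nested in [y], so would [b] be; uniqueness gives [x = y], but nothing is nested in
    itself. *)
Lemma nested_hull_outer b x : nested lt b x -> ~~ inner lt x.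
Proof.
move=> bx; apply/negP=> /existsP[y xy].
have by_ : nested lt b y.
  case/nestedP: xy => a [c [ax' nay xc nyc]]; apply/nestedP; exists a, c.
  split=> //; first exact: nested_pred bx _.
  case/nestedP: bx => a' [c' [_ _ bc' nxc']].
  by have := fa_22 ax xc bc'; rewrite (negPf nxc').
rewrite (nested_hull_uniq bx by_) in xy.
by case/nestedP: xy => a [c [-> //]].
Qed.

(* An element below the middle [b] but not below its hull [x] cannot itself be
   a middle; this is where [Z] is excluded. *)
Lemma nested_pred_outer b x a :
  nested lt b x -> lt a b -> ~~ lt a x -> ~~ inner lt a.
Proof.
move=> bx ab nax; apply/negP=> /existsP[y /nestedP[a0 [c0 [a0a na0y ac0 nyc0]]]].
have /nestedP[_ [c [_ _ bc nxc]]] := bx.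
(* If [y] precedes [b], then either [c0] and [b] both lie between [a] and [c], against D, or [c0] is
   a second hull of [b]. *)
case: (boolP (lt y b)) => [yb|nyb]; last exact: (fa_Z ax a0a ab bc na0y nyb nax).
case: (boolP (lt c0 c)) => [c0c|nc0c].
  by have e := fa_D ax ab bc ac0 c0c nax nxc; rewrite e (negPf nyc0) in yb.
have bc0 : nested lt b c0 by apply/nestedP; exists y, c.
by rewrite (nested_hull_uniq bx bc0) ac0 in nax.
Qed.

Lemma nested_pred_uniq b x a a' : nested lt b x ->
  lt a b -> ~~ lt a x -> lt a' b -> ~~ lt a' x -> a = a'.
Proof.
move=> /nestedP[_ [c [_ _ bc nxc]]] ab nax a'b na'x.
exact: (fa_Ydual ax ab a'b bc nax na'x nxc).
Qed.

(** A predecessor and a successor of one element, both missing from the other, would make the former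
    a middle; [fa_22] handles the mixed cases. *)
Lemma outer_total x y : ~~ inner lt x -> ~~ inner lt y ->
  ((forall z, lt z x -> lt z y) /\ (forall z, lt y z -> lt x z)) \/
  ((forall z, lt z y -> lt z x) /\ (forall z, lt x z -> lt y z)).
Proof.
have preds u v : (forall z, lt z u -> lt z v) \/ exists2 a, lt a u & ~~ lt a v.
  case: (boolP [forall z, lt z u ==> lt z v]) => [/forallP H|].
    by left=> z zu; apply: (implyP (H z)).
  by rewrite negb_forall => /existsP[a]; rewrite negb_imply => /andP[]; right; exists a.
have succs u v : (forall z, lt u z -> lt v z) \/ exists2 c, lt u c & ~~ lt v c.
  case: (boolP [forall z, lt u z ==> lt v z]) => [/forallP H|].
    by left=> z zu; apply: (implyP (H z)).
  by rewrite negb_forall => /existsP[a]; rewrite negb_imply => /andP[]; right; exists a.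
move=> ox oy.
case: (preds x y) => [xy|[a ax' nay]]; case: (succs y x) => [yx|[c yc nxc]].
- by left.
- case: (preds y x) => [yx|[a ay nax]]; last first.
    by case/negP: oy; apply/existsP; exists x; apply/nestedP; exists a, c.
  right; split=> // z xz; have := fa_22 ax xz yc.
  by rewrite (negPf nxc).
- right; split=> [z zy|]; first by have := fa_22 ax ax' zy; rewrite (negPf nay).
  case: (succs x y) => // -[c xc nyc].
  by case/negP: ox; apply/existsP; exists y; apply/nestedP; exists a, c.
- right; split=> z; first by move=> zy; have := fa_22 ax ax' zy; rewrite (negPf nay).
  by move=> xz; have := fa_22 ax xz yc; rewrite (negPf nxc).
Qed.

Lemma trace_key_le x y : ~~ inner lt x -> ~~ inner lt y ->
  trace_key lt x <= trace_key lt y ->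
  (forall z, lt z x -> lt z y) /\ (forall z, lt y z -> lt x z).
Proof.
move=> ox oy le_xy; case: (outer_total ox oy) => // -[yx xy].
have sub1 : [set z | lt z y] \subset [set z | lt z x].
  by apply/subsetP=> z; rewrite !inE; apply: yx.
have sub2 : [set z | ~~ lt y z] \subset [set z | ~~ lt x z].
  by apply/subsetP=> z; rewrite !inE; apply/contra/xy.
have c1 := subset_leq_card sub1; have c2 := subset_leq_card sub2.
rewrite /trace_key in le_xy.
(* The key inequality opposes both inclusions, so each must be an equality. *)
have /eqP/setP e1 : [set z | lt z y] == [set z | lt z x].
  by rewrite eqEcard sub1 -(leq_add2r #|[set z | ~~ lt y z]|)
    (leq_trans _ le_xy) // leq_add2l.
have /eqP/setP e2 : [set z | ~~ lt y z] == [set z | ~~ lt x z].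
  by rewrite eqEcard sub2 -(leq_add2l #|[set z | lt z y]|)
    (leq_trans _ le_xy) // leq_add2r.
split=> z; first by have := e1 z; rewrite !inE => ->.
by have := e2 z; rewrite !inE => /negb_inj ->.
Qed.

End Nested.

(** * Construction of the unit representation *)

Section Representation.
Variables (X : finType) (lt : rel X).
Hypothesis ax : forbidden_axioms lt.
Hypothesis free : twin_free lt.

Let axd := forbidden_axioms_dual ax.

Lemma nested_succ b x z : nested lt b x -> lt x z -> lt b z.
Proof. by rewrite -nested_dual; apply: (nested_pred axd). Qed.

Lemma nested_succ_outer b x c :
  nested lt b x -> lt b c -> ~~ lt x c -> ~~ inner lt c.
Proof. by rewrite -nested_dual -inner_dual; apply: (nested_pred_outer axd). Qed.

Lemma nested_succ_uniq b x c c' : nested lt b x ->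
  lt b c -> ~~ lt x c -> lt b c' -> ~~ lt x c' -> c = c'.
Proof. by rewrite -nested_dual; apply: (nested_pred_uniq axd). Qed.

Lemma trace_key_inj x y : ~~ inner lt x -> ~~ inner lt y ->
  trace_key lt x = trace_key lt y -> x = y.
Proof.
move=> ox oy e.
have [xy yx] := trace_key_le ax ox oy (eq_leq e).
have [yx' xy'] := trace_key_le ax oy ox (eq_leq (esym e)).
by apply: free => z; split; apply/idP/idP; auto.
Qed.

Lemma weak_lt_key x y : ~~ inner lt x -> ~~ inner lt y ->
  weak_lt lt x y -> trace_key lt x < trace_key lt y.
Proof.
move=> ox oy wxy; rewrite ltnNge; apply/negP=> le_yx.
have [yx xy] := trace_key_le ax oy ox le_yx.
case/or3P: wxy => [/yx|/existsP[b /and3P[ny xb _]]|/existsP[b /and3P[nx by_ _]]].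
- by apply/negP/fa_irr.
- by have := nested_succ ny (xy _ xb); apply/negP/fa_irr.
- by have := nested_pred ax nx (yx _ by_); apply/negP/fa_irr.
Qed.

(** A touching pair is extremal: if moving [x] down or [y] up kept the contact, a middle would get a
    second hull, or its hull a second touching neighbour on the same side. *)
Lemma weak_lt_mono x y x' y' :
  ~~ inner lt x -> ~~ inner lt y -> ~~ inner lt x' -> ~~ inner lt y' ->
  weak_lt lt x y -> trace_key lt x' <= trace_key lt x ->
  trace_key lt y <= trace_key lt y' -> (x' != x) || (y' != y) -> lt x' y'.
Proof.
move=> ox oy ox' oy' wxy /(trace_key_le ax ox' ox)[xx1 xx2].
move=> /(trace_key_le ax oy oy')[yy1 yy2] neq.
case/or3P: wxy => [/xx2/yy1 //|/existsP[b /and3P[ny xb nxy]]|].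
  case: (eqVneq y' y) => [ey|neq_y].
    apply/negPn/negP=> nx'y'; move: neq; rewrite ey eqxx orbF => /eqP; apply.
    by apply: (nested_pred_uniq ax ny) => //; [apply: xx2 | rewrite -ey].
  apply: xx2; apply/negPn/negP=> nxy'; case/eqP: neq_y.
  apply: (nested_hull_uniq ax _ ny); apply/nestedP.
  case/nestedP: ny => _ [c [_ _ bc nyc]]; exists x, c; split=> //.
  exact: contra (yy2 c) nyc.
move=> /existsP[b /and3P[nx by_ nxy]].
case: (eqVneq x' x) neq => [ex /= neq|neq_x _].
  apply/negPn/negP=> nx'y'; case/eqP: neq.
  by apply: (nested_succ_uniq nx) => //; [apply: yy1 | rewrite -ex].
apply: yy1; apply/negPn/negP=> nx'y; case/eqP: neq_x.
apply: (nested_hull_uniq ax _ nx); apply/nestedP.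
case/nestedP: nx => a [_ [ab nax _ _]]; exists a, y; split=> //.
exact: contra (xx1 a) nax.
Qed.

Variant hull_spec b : bool -> X -> Prop :=
  | HullOuter of ~~ inner lt b : hull_spec b false b
  | HullInner x of nested lt b x : hull_spec b true x.

Lemma hullP b : hull_spec b (inner lt b) (hull lt b).
Proof.
rewrite /hull; case: pickP => [x bx|no] /=.
  have -> : inner lt b by apply/existsP; exists x.
  exact: HullInner.
have nb : ~~ inner lt b by apply/existsP=> -[x]; rewrite no.
by rewrite (negPf nb); constructor.
Qed.

Lemma hull_outer b : ~~ inner lt (hull lt b).
Proof. by case: hullP => // x /(nested_hull_outer ax). Qed.

(** This mirrors the endpoint test for intervals: two closed ones need a gap, while contact suffices
    once one is open. *)
Lemma lt_hullE u v : lt u v =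
  if ~~ inner lt u && ~~ inner lt v then lt (hull lt u) (hull lt v)
  else weak_lt lt (hull lt u) (hull lt v).
Proof.
case: (hullP u) => [ou|x ux]; case: (hullP v) => [ov|y vy] //=; apply/idP/idP.
- move=> uv; rewrite /weak_lt; case: (boolP (lt u y)) => //= nuy.
  by apply/orP; left; apply/existsP; exists v; rewrite vy uv.
- case/or3P=> [|/existsP[b /and3P[bn ub _]]|/existsP[b /and3P[bn b_y nuy]]].
  + exact: nested_pred.
  + by rewrite (nested_inner_uniq ax vy bn).
  (* Otherwise [v] lies above the middle [b] but not above its hull [u], so [v] could not be a
     middle. *)
  + apply/negPn/negP=> nuv.
    have := nested_succ_outer bn (nested_pred ax vy b_y) nuv.
    by case/negP; apply/existsP; exists y.
- move=> uv; rewrite /weak_lt; case: (boolP (lt x v)) => //= nxv.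
  by apply/orP; right; apply/existsP; exists u; rewrite ux uv.
- case/or3P=> [|/existsP[b /and3P[bn xb nxv]]|/existsP[b /and3P[bn bv _]]].
  + exact: nested_succ.
  + apply/negPn/negP=> nuv.
    have := nested_pred_outer ax bn (nested_succ ux xb) nuv.
    by case/negP; apply/existsP; exists x.
  + by rewrite (nested_inner_uniq ax ux bn).
- move=> uv; have uy : lt u y.
    apply/negPn/negP=> nuy; have := nested_pred_outer ax vy uv nuy.
    by case/negP; apply/existsP; exists x.
  rewrite /weak_lt; case: (boolP (lt x y)) => //= nxy.
  by apply/orP; right; apply/existsP; exists u; rewrite ux uy.
- case/or3P=> [xy|/existsP[b /and3P[bn xb _]]|/existsP[b /and3P[bn b_y _]]].
  + exact/(nested_pred ax vy)/(nested_succ ux).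
  + by apply: (nested_succ ux); rewrite (nested_inner_uniq ax vy bn).
  + by apply: (nested_pred ax vy); rewrite (nested_inner_uniq ax ux bn).
Qed.

Lemma axioms_unit_OC : unit_OC_interval_order lt.
Proof.
have outerE x : (x \in [set x | ~~ inner lt x]) = ~~ inner lt x by rewrite inE.
have [f fP] : exists f : X -> R, {in [set x | ~~ inner lt x] &, forall x y,
    [/\ trace_key lt x < trace_key lt y -> (f x < f y)%R,
        lt x y <-> (f x + 1 < f y)%R & weak_lt lt x y <-> (f x + 1 <= f y)%R]}.
  apply: double_threshold_rep.
  - by move=> x y; rewrite !outerE; apply: trace_key_inj.
  - by move=> x y xy; rewrite /weak_lt xy.
  - by move=> x y; rewrite !outerE; apply: weak_lt_key.
  - by move=> x y + + x' y'; rewrite !outerE; apply: weak_lt_mono.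
(* The thresholds [f x + 1 < f y] and [f x + 1 <= f y] are now the two cases of [oc_beforeE]. *)
pose I x := OCInt (f (hull lt x)) (f (hull lt x) + 1) (~~ inner lt x).
have wf x : ocint_wf (I x) by rewrite /ocint_wf /=; case: ifP => _; lra.
exists I; split; last by move=> x y; rewrite /oc_length /=; lra.
split=> // x y; rewrite oc_beforeE // lt_hullE /=.
have hullA z : hull lt z \in [set x | ~~ inner lt x] by rewrite outerE hull_outer.
by have [_ SE WE] := fP _ _ (hullA x) (hullA y); case: ifP.
Qed.

End Representation.

Theorem theorem12 (X : finType) (lt : rel X) :
  strict_porder lt -> twin_free lt -> interval_order lt ->
  (unit_OC_interval_order lt <-> strict_OC_interval_order lt) /\
  (strict_OC_interval_order lt <-> forbidden_free lt).
Proof.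
move=> po free io.
have to_free : strict_OC_interval_order lt -> forbidden_free lt.
  by move=> [I [repI strictI]]; apply: strict_forbidden_free repI strictI.
have to_unit : forbidden_free lt -> unit_OC_interval_order lt.
  by move=> ff; apply: axioms_unit_OC => //; apply: forbidden_free_axioms.
split; split=> //; first exact: unit_OC_strict.
  by move/to_free/to_unit.
by move/to_unit/unit_OC_strict.
Qed.
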